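(* Let $x\in X=(0,1)\setminus\mathbb{Q}$ be a Wilton–Cremer number. Then the function $\Upsilon$ is not differentiable at $x$.
   Context: $\{t\}$ is the fractional part of $t$. For $x\in X=(0,1)\setminus\mathbb{Q}$ put $\alpha(x)=\{1/x\}$, $\alpha_0(x)=x$, $\alpha_k(x)=\alpha(\alpha_{k-1}(x))$ for $k\ge1$, $\beta_{-1}=1$, $\beta_k(x)=\alpha_0(x)\cdots\alpha_k(x)$, $\gamma_k(x)=\beta_{k-1}(x)\log(1/\alpha_k(x))$, and consider the series $\mathcal{W}(x)=\sum_{k\ge0}(-1)^k\gamma_k(x)$. It converges for almost every $x\in(0,1)$ and defines a function in $L^1(0,1)$. A point $x\in X$ is a Wilton number if this series converges, and a Wilton–Cremer number if it diverges. $\Upsilon(x)=\int_0^x\mathcal{W}(t)\,dt$ for $0\le x\le1$. *)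

(* Defs.v *)
From HB Require Import structures.
From mathcomp Require Import all_boot all_order all_algebra.
From mathcomp Require Import all_classical all_reals all_analysis.
Set Implicit Arguments.
Unset Strict Implicit.
Unset Printing Implicit Defensive.
Import Order.TTheory GRing.Theory Num.Theory.
Import numFieldNormedType.Exports.
Local Open Scope classical_set_scope.
Local Open Scope ring_scope.

Definition frac_part (R : realType) (t : R) : R := t - (Num.floor t)%:~R.

Definition irrational01 (R : realType) : set R := `]0, 1[ `&` @irrational R.

(* Total on R; only its restriction to irrational01, which it maps into itself,
   is meaningful. *)
Definition gauss_map (R : realType) (x : R) : R := frac_part (1 / x).

Definition gauss_iter (R : realType) (k : nat) (x : R) : R :=
  iter k (@gauss_map R) x.

(* The index is shifted by one to accommodate beta_{-1} = 1:
   beta_pred k x is beta_{k-1}(x) = alpha_0(x) ... alpha_{k-1}(x). *)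
Definition beta_pred (R : realType) (k : nat) (x : R) : R :=
  \prod_(0 <= i < k) gauss_iter i x.

Definition wilton_gamma (R : realType) (k : nat) (x : R) : R :=
  beta_pred k x * ln (1 / gauss_iter k x).

Definition wilton_series (R : realType) (x : R) : R^nat :=
  series (fun k : nat => (-1) ^+ k * wilton_gamma k x).

(* Where the series diverges, limn returns a default value; together with the
   rationals, such points form a Lebesgue-null subset of (0, 1). *)
Definition wilton_function (R : realType) (x : R) : R :=
  limn (wilton_series x).

(* Convergence of a sequence in R means convergence to a finite limit. *)
Definition Wilton_number (R : realType) (x : R) : Prop :=
  irrational01 x /\ cvgn (wilton_series x).

Definition Wilton_Cremer_number (R : realType) (x : R) : Prop :=
  irrational01 x /\ ~ cvgn (wilton_series x).

(* Meaningful for 0 <= x <= 1. Differentiability at a point of ]0, 1[ does not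
   depend on the values taken outside that interval. *)
Definition Upsilon (R : realType) (x : R) : R :=
  \int[@lebesgue_measure R]_(t in `[0, x]) wilton_function t.

(* Main.v *)
Require Import Defs.
From HB Require Import structures.
From mathcomp Require Import all_boot all_order all_algebra.
From mathcomp Require Import all_classical all_reals all_analysis.
From mathcomp Require Import measurable_realfun ring lra.
Set Implicit Arguments.
Unset Strict Implicit.
Unset Printing Implicit Defensive.
Import Order.TTheory GRing.Theory Num.Theory.
Import numFieldNormedType.Exports.
Local Open Scope classical_set_scope.
Local Open Scope ring_scope.

(** The idea is that the mean of W over small intervals shrinking to x follows
the partial sums of the series at x.  So if Upsilon had a derivative at x,
these partial sums would converge to it, and x would not be a Wilton-Cremer
number.

Fix x irrational and a depth K, and write a_k for [gauss_iter k] and B_K for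
[beta_pred K], the product of a_0, ..., a_(K-1).  Let the cell of x be the set
of points sharing the first K partial quotients of x ([cell]).  For s and t in
it,

  |s - t| = B_K(s) B_K(t) |a_K(s) - a_K(t)|     ([gauss_iter_dist]),

and B_K varies by a factor at most 2 on the cell ([beta_le2]), because its
inverse is an affine function of a_K with nonnegative coefficients, the one of
a_K being the smaller.  Since a_K maps the cell onto ]0, 1[, some s in the cell
is at distance B_K(s) B_K(x) / 4 from x ([cell_companion]); this is the length
of the cell up to a constant.  The increment of Upsilon between x and s is
compared with (s - x) S_K(x), where S_K is the K-th partial sum
([Upsilon_increment]), by splitting W = S_K + (W - S_K).

- On the cell, S_K differs from S_K(x) by at most 24 B_K(x)
  ([wilton_series_variation]).
- Since gamma_(K+j) = B_K * gamma_j(a_K), the rest W - S_K is almost everywhere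
  at most B_K * Phi(a_K), where Phi = sum_k |gamma_k| ([wilton_tail_le]).  The
  map a_K expands distances on the cell by a factor of order 1 / |s - x|, so
  the mean of Phi(a_K) between x and s is at most a constant times the integral
  of Phi over ]0, 1[ ([ge0_integral_cell_le]).

So the slope of Upsilon between x and s differs from S_K(x) by at most a constant
times B_K(x), which tends to 0.

It remains to see that Phi is integrable; this gives both the almost everywhere
convergence of the series and the integrability of W.  Summing the cell
estimate over all cells of depth k, whose lengths add up to at most 1, bounds
the integral of f(a_k) by 16 times that of f ([ge0_integral_gauss_iter_le]).
Taking f = ln(1/.) and using that B_k decays geometrically bounds the integral
of |gamma_k| by the terms of a geometric series. *)

(** * Cells of the Gauss map *)

Section gauss_orbits.
Context {R : realType}.
Implicit Types (x y s t u : R) (k K m n : nat).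

Lemma inv_gauss_mapE x : x^-1 = (Num.floor (1 / x))%:~R + gauss_map x.
Proof. by rewrite /gauss_map /frac_part addrC subrK div1r. Qed.

Lemma gauss_map_itv x : 0 <= gauss_map x < 1.
Proof.
have := floorD1_gt (1 / x); have := ge_floor (1 / x).
by rewrite /gauss_map /frac_part intrD; lra.
Qed.

Lemma floor_inv_ge1 x : 0 < x < 1 -> 1 <= (Num.floor (1 / x))%:~R :> R.
Proof.
move=> /andP[x0 x1].
have : 1 <= Num.floor (1 / x).
  by rewrite floor_ge_int_tmp div1r invf_ge1// ltW.
by rewrite -(ler_int R).
Qed.

Lemma gauss_iterSr k x : gauss_iter k.+1 x = gauss_iter k (gauss_map x).
Proof. exact: iterSr. Qed.

Lemma gauss_iterD m n x : gauss_iter (m + n) x = gauss_iter m (gauss_iter n x).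
Proof. exact: iterD. Qed.

Lemma gauss_iter_itv k x : 0 <= x < 1 -> 0 <= gauss_iter k x < 1.
Proof. by case: k => // k _; exact: gauss_map_itv. Qed.

Lemma beta_pred0 x : beta_pred 0 x = 1.
Proof. by rewrite /beta_pred big_nil. Qed.

Lemma beta_predS k x : beta_pred k.+1 x = beta_pred k x * gauss_iter k x.
Proof. by rewrite /beta_pred big_nat_recr. Qed.

Lemma beta_predD m n x :
  beta_pred (m + n) x = beta_pred m x * beta_pred n (gauss_iter m x).
Proof.
elim: n => [|n IH]; first by rewrite addn0 beta_pred0 mulr1.
by rewrite addnS !beta_predS IH -mulrA addnC gauss_iterD.
Qed.

Lemma beta_predSr k x : beta_pred k.+1 x = x * beta_pred k (gauss_map x).
Proof. by rewrite -add1n beta_predD beta_predS beta_pred0 mul1r. Qed.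

Lemma beta_pred_ge0 K x : 0 <= x < 1 -> 0 <= beta_pred K x.
Proof.
move=> x01; elim: K => [|K IH]; rewrite ?beta_pred0// beta_predS mulr_ge0//.
by have /andP[] := gauss_iter_itv K x01.
Qed.

Lemma mul_gauss_map_le x : 0 <= x < 1 -> x * gauss_map x <= 1 / 2.
Proof.
move=> /andP[]; rewrite le_eqVlt => /predU1P[<- _|x0 x1].
  by rewrite mul0r.
have := @floor_inv_ge1 x; rewrite x0 x1 => /(_ isT) n1.
have := inv_gauss_mapE x; have /andP[a0 a1] := gauss_map_itv x.
move: (gauss_map x) (_%:~R) a0 a1 n1 => a n a0 a1 n1 xE.
have : x * (n + a) = 1 by rewrite -xE mulfV// gt_eqF.
by nra.
Qed.

(** Two consecutive factors have product at most 1/2, which is below (3/4)^2;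
the factor 2 pays for an isolated first one. *)
Lemma beta_pred_le K x : 0 <= x < 1 -> beta_pred K x <= 2 * (3 / 4) ^+ K.
Proof.
have [n] := ubnP K; elim: n K x => // n IH [|[|K]] x Kn x01.
- by rewrite beta_pred0 expr0; lra.
- by rewrite beta_predS beta_pred0 expr1 /gauss_iter /=; case/andP: x01; lra.
rewrite !beta_predSr mulrA.
have a01 := gauss_map_itv x; have aa01 := gauss_map_itv (gauss_map x).
have b0 := beta_pred_ge0 K aa01.
have {IH} := IH K (gauss_map (gauss_map x)) (ltn_trans (ltnSn _) Kn) aa01.
have := mul_gauss_map_le x01.
rewrite 2!exprS; move: (_ ^+ K) (beta_pred _ _) b0 => p b b0.
move: (x * _) => c; nra.
Qed.

Lemma beta_pred_le1 K x : 0 <= x < 1 -> beta_pred K x <= 1.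
Proof.
move=> x01; elim: K => [|K IH]; rewrite ?beta_pred0// beta_predS.
have /andP[a0 a1] := gauss_iter_itv K x01.
by rewrite mulr_ile1// ?beta_pred_ge0// ltW.
Qed.

(** The requirement that all the iterates, the K-th included, lie in ]0, 1[
makes [gauss_iter K] map each cell into ]0, 1[ and keeps the logarithms of the
series away from 0. A point x belongs to its own cell exactly when its iterates
of ranks 0 to K are in ]0, 1[, hence the hypotheses [cell K x x] below. *)
Definition cell K x : set R :=
  [set t | (forall k, (k <= K)%N -> 0 < gauss_iter k t < 1) /\
    (forall k, (k < K)%N ->
      Num.floor (1 / gauss_iter k t) = Num.floor (1 / gauss_iter k x))].

Lemma cell0 x t : cell 0 x t <-> 0 < t < 1.
Proof.
split=> [[/(_ 0%N)/(_ isT)]//|t01].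
by split=> // k; rewrite leqn0 => /eqP ->.
Qed.

Lemma cellS K x t : cell K.+1 x t <->
  [/\ 0 < t < 1, Num.floor (1 / t) = Num.floor (1 / x) &
      cell K (gauss_map x) (gauss_map t)].
Proof.
split=> [[t01 tx]|[t01 tx [at01 atx]]]; last first.
  by split=> -[|k]// ?; rewrite !gauss_iterSr ?at01 ?atx.
split; [exact: (t01 0%N)|exact: (tx 0%N)|split=> k kK].
- by rewrite -gauss_iterSr t01.
- by rewrite -!gauss_iterSr tx.
Qed.

Lemma cell_le k K x t : (k <= K)%N -> cell K x t -> cell k x t.
Proof.
move=> kK [t01 tx]; split=> j jk; first exact/t01/(leq_trans jk).
exact/tx/(leq_trans jk).
Qed.

Lemma cell_gauss_iter k K x t : cell (k + K) x t ->
  cell K (gauss_iter k x) (gauss_iter k t).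
Proof.
move=> [t01 tx]; split=> j jK; rewrite -!gauss_iterD addnC.
  by rewrite t01// leq_add2l.
by rewrite tx// ltn_add2l.
Qed.

Lemma cell_trans K x s t : cell K x s -> cell K x t -> cell K s t.
Proof. by move=> [_ sx] [t01 tx]; split=> // k kK; rewrite tx// sx. Qed.

Lemma cell_itv K x t : cell K x t -> 0 < t < 1.
Proof. by case=> /(_ 0%N)/(_ isT). Qed.

Lemma cell_itvW K x t : cell K x t -> 0 <= t < 1.
Proof. by move=> /cell_itv/andP[/ltW -> ->]. Qed.

Lemma cell_beta_gt0 K x t : cell K x t -> 0 < beta_pred K t.
Proof.
elim: K => [|K IH] tK; rewrite ?beta_pred0// beta_predS mulr_gt0//.
  exact/IH/(cell_le _ tK).
by case: tK => /(_ K (leqnSn K))/andP[].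
Qed.

(** Two points with the same first partial quotient satisfy s - t = - s t
(gauss_map s - gauss_map t), since 1 / s and 1 / t have the same integral part;
the formula iterates this identity. *)
Lemma gauss_iter_dist K x s t : cell K x s -> cell K x t ->
  `|s - t| = beta_pred K s * beta_pred K t * `|gauss_iter K s - gauss_iter K t|.
Proof.
elim: K x s t => [|K IH] x s t; first by rewrite !beta_pred0 !mul1r.
move=> /cellS[/andP[s0 _] sx sK] /cellS[/andP[t0 _] tx tK].
rewrite !gauss_iterSr !beta_predSr.
transitivity (s * t * `|gauss_map s - gauss_map t|); last first.
  by rewrite (IH _ _ _ sK tK); ring.
have := inv_gauss_mapE s; have := inv_gauss_mapE t; rewrite sx tx => t1 s1.
rewrite (_ : gauss_map s - gauss_map t = s^-1 - t^-1); last first.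
  by rewrite s1 t1; ring.
rewrite -{1}[s * t]gtr0_norm ?mulr_gt0// -normrM distrC; congr `|_|.
by field; rewrite !gt_eqF.
Qed.

(** When the cell is not empty, q and q' are the denominators of the last two
convergents shared by its points; the induction is their recurrence relation.
*)
Lemma beta_affine K x : exists q q', 0 <= q' <= q /\
  forall t, cell K x t -> (q + q' * gauss_iter K t) * beta_pred K t = 1.
Proof.
elim: K => [|K [q [q' [/andP[q'0 q'q] qE]]]].
  exists 1, 0; split; first by lra.
  by move=> t _; rewrite beta_pred0; ring.
have [xK|xK] := pselect (exists t, cell K.+1 x t); last first.
  by exists 0, 0; split=> [|t tK]; [lra|case: xK; exists t].
set d : R := (Num.floor (1 / gauss_iter K x))%:~R.
have d1 : 1 <= d.
  case: xK => t [/(_ K (leqnSn K)) tK01 /(_ K (ltnSn K)) tx].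
  by rewrite /d -tx floor_inv_ge1.
exists (d * q + q'), q; split; first by nra.
move=> t tK; have [/(_ K (leqnSn K))/andP[tK0 _] /(_ K (ltnSn K)) tx] := tK.
have <- := qE t (cell_le (leqnSn K) tK).
have : gauss_iter K t * (d + gauss_iter K.+1 t) = 1.
  by rewrite /d -tx -inv_gauss_mapE mulfV// gt_eqF.
rewrite beta_predS; move: (gauss_iter K.+1 t) => a' aa'.
transitivity (((gauss_iter K t * (d + a')) * q + q' * gauss_iter K t) *
  beta_pred K t); first by ring.
by rewrite aa'; ring.
Qed.

Lemma beta_dist K x s t : cell K x s -> cell K x t ->
  `|beta_pred K s - beta_pred K t| <=
    beta_pred K t * `|gauss_iter K s - gauss_iter K t|.
Proof.
move=> sK tK; have [q [q' [/andP[q'0 q'q] qE]]] := beta_affine K x.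
have bs := cell_beta_gt0 sK; have bt := cell_beta_gt0 tK.
have sE := qE _ sK; have tE := qE _ tK.
have /andP[s0 _] : 0 < gauss_iter K s < 1 by case: sK => /(_ _ (leqnn K)).
move: (beta_pred K s) (beta_pred K t) (gauss_iter K s) (gauss_iter K t)
  bs bt s0 sE tE => b c a e b0 c0 a0 bE cE.
have -> : b - c = - (b * q') * (c * (a - e)).
  rewrite -[LHS]mulr1; rewrite -[b in LHS]mulr1 -[c in LHS]mulr1 mulr1.
  by rewrite -{1}cE -{1}bE; ring.
(* Here q' <= q <= 1 / b, by the affine formula at s. *)
have bq' : b * q' <= 1 by nra.
rewrite normrM normrN (ger0_norm (_ : 0 <= b * q')); last by nra.
rewrite normrM (gtr0_norm c0) ler_piMl//.
by rewrite mulr_ge0// ltW.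
Qed.

(** The bounded distortion property of the branches of the Gauss iterates. *)
Lemma beta_le2 K x s t : cell K x s -> cell K x t ->
  beta_pred K s <= 2 * beta_pred K t.
Proof.
move=> sK tK; have := beta_dist sK tK.
have := cell_beta_gt0 tK.
have /andP[s0 s1] : 0 < gauss_iter K s < 1 by case: sK => /(_ _ (leqnn K)).
have /andP[t0 t1] : 0 < gauss_iter K t < 1 by case: tK => /(_ _ (leqnn K)).
have : `|gauss_iter K s - gauss_iter K t| <= 1 by rewrite ler_norml; lra.
move: (`|_ - _|) => d d1 bt; rewrite ler_norml => /andP[_].
by nra.
Qed.

(** The preimage is built by adding the partial quotients of x back, one at a
time, through s := 1 / (n + s). *)
Lemma gauss_iter_onto K x u : cell K x x -> 0 < u < 1 ->
  exists2 s, cell K x s & gauss_iter K s = u.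
Proof.
elim: K x => [|K IH] x; first by move=> _ u01; exists u => //; exact/cell0.
move=> /cellS[x01 _ xK] u01; have [s sK su] := IH _ xK u01.
have s01 := cell_itv sK; have /andP[s0 s1] := s01.
have n1 := floor_inv_ge1 x01.
set n := Num.floor (1 / x) in n1 *.
have fE : Num.floor (1 / (n%:~R + s)^-1) = n.
  rewrite div1r invrK; apply/eqP; rewrite floor_eq intrD.
  by apply/andP; split; lra.
have gE : gauss_map (n%:~R + s)^-1 = s.
  by rewrite /gauss_map /frac_part fE div1r invrK addrC addKr.
exists (n%:~R + s)^-1; last by rewrite gauss_iterSr gE.
apply/cellS; rewrite gE fE; split => //.
have ns : 1 < n%:~R + s by lra.
by rewrite invr_gt0 invf_lt1//; lra.
Qed.

Lemma cell_convex K x s t y : cell K x s -> cell K x t -> s <= y <= t ->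
  cell K x y.
Proof.
elim: K x s t y => [|K IH] x s t y.
  by move=> /cell0 s01 /cell0 t01 syt; apply/cell0; lra.
move=> /cellS[s01 sx sK] /cellS[t01 tx tK] /andP[sy yt].
have ty' : t^-1 <= y^-1 by rewrite lef_pV2// posrE; lra.
have ys' : y^-1 <= s^-1 by rewrite lef_pV2// posrE; lra.
have yx : Num.floor (1 / y) = Num.floor (1 / x).
  by apply/eqP; rewrite eq_le -{1}sx -tx !div1r !le_floor.
apply/cellS; split => //; first by lra.
apply: (IH _ _ _ _ tK sK).
have := inv_gauss_mapE s; have := inv_gauss_mapE t; have := inv_gauss_mapE y.
rewrite yx sx tx; lra.
Qed.

(** The point s is the one whose K-th iterate is at distance 1/4 from that of
x, on the side where there is room in ]0, 1[. By bounded distortion, the length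
of the cell is at most a constant times the distance from s to x. *)
Lemma cell_companion K x : cell K x x ->
  exists2 s, cell K x s & `|s - x| = beta_pred K s * beta_pred K x / 4.
Proof.
move=> xK; have xK01 : 0 < gauss_iter K x < 1 by case: xK => /(_ _ (leqnn K)).
have [lt|ge] := ltP (gauss_iter K x) (1 / 2).
  have [|s sK sE] := @gauss_iter_onto K x (gauss_iter K x + 1 / 4) xK.
    by lra.
  exists s => //; rewrite (gauss_iter_dist sK xK) sE.
  by rewrite addrAC subrr add0r gtr0_norm// mul1r.
have [|s sK sE] := @gauss_iter_onto K x (gauss_iter K x - 1 / 4) xK.
  by lra.
exists s => //; rewrite (gauss_iter_dist sK xK) sE.
by rewrite addrAC subrr add0r normrN gtr0_norm// mul1r.
Qed.

End gauss_orbits.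

(** * Integrals along expanding maps *)

Section expanding_maps.
Context {R : realType}.
Notation mu := (@lebesgue_measure R).
Local Open Scope ereal_scope.

Lemma lebesgue_measure_le_diameter (A : set R) (d : R) : measurable A ->
  (0 <= d)%R -> (forall s t, A s -> A t -> (`|s - t| <= d)%R) -> mu A <= d%:E.
Proof.
move=> mA d0 Ad; have [->|/set0P A0] := eqVneq A set0.
  by rewrite measure0 lee_fin.
have [a Aa] := A0.
have lA : has_lbound A.
  exists (a - d)%R => t At; have := Ad _ _ Aa At.
  by rewrite ler_norml => /andP[_]; rewrite lerBlDl -lerBlDr.
have AI : A `<=` `[inf A, (inf A + d)%R].
  move=> t At /=; rewrite in_itv/= ge_inf//= -lerBlDr lb_le_inf//.
  move=> s As; have := Ad _ _ At As.
  by rewrite ler_norml => /andP[_]; rewrite lerBlDl -lerBlDr.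
apply: (@le_trans _ _ (mu `[inf A, (inf A + d)%R])).
  by apply: le_measure; rewrite ?inE.
rewrite lebesgue_measure_itv/= lte_fin; case: ifPn => _.
  2: by rewrite lee_fin.
by rewrite -EFinB lee_fin addrAC subrr add0r.
Qed.

(** The image under g of the Lebesgue measure on D gives an interval a mass at
most L times its length, since the preimage has diameter at most that much;
covering by intervals extends the comparison to all Borel sets, then to
integrals. *)
Lemma ge0_integral_expanding_le (D E : set R) (g : R -> R) (L : R)
    (f : R -> \bar R) : (0 < L)%R ->
  measurable D -> measurable E -> (forall t, D t -> E (g t)) ->
  measurable_fun [set: R] g ->
  (forall s t, D s -> D t -> (`|s - t| <= L * `|g s - g t|)%R) ->
  measurable_fun [set: R] f -> (forall y, 0 <= f y) ->
  \int[mu]_(t in D) f (g t) <= L%:E * \int[mu]_(y in E) f y.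
Proof.
move=> L0 mD mE DE mg expg mf f0.
have mgV Y : measurable Y -> measurable (g @^-1` Y).
  by move=> mY; rewrite -[X in measurable X]setTI; exact: mg.
have mg' : @measurable_fun _ _ (measurableTypeR R) (measurableTypeR R) setT g.
  exact: mg.
pose rho : {measure set (measurableTypeR R) -> \bar R} := mrestr mu mD.
pose nu_ : {measure set (measurableTypeR R) -> \bar R} :=
  pushforward rho (g : measurableTypeR R -> measurableTypeR R).
pose nu := nu_ mg'.
pose L' := NngNum (ltW L0).
pose Lmu : {measure set (measurableTypeR R) -> \bar R} := mscale L' mu.
have nuI (a b : R) : nu `]a, b]%classic <= L%:E * wlength idfun `]a, b]%classic.
  rewrite wlength_itv/= lte_fin; case: ifPn => [ab|].
    rewrite -EFinB -EFinM lebesgue_measure_le_diameter//.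
    - by apply: measurableI => //; exact: mgV.
    - by rewrite mulr_ge0 ?(ltW L0)// subr_ge0 ltW.
    move=> s t [/= + Ds] [/= + Dt]; rewrite !in_itv/= => sab tab.
    apply: (le_trans (expg _ _ Ds Dt)); apply: ler_wpM2l; first exact: ltW.
    by rewrite ler_norml; lra.
  rewrite -leNgt mule0 => ba.
  by rewrite set_itv_ge ?bnd_simp -?leNgt// measure0.
have le_nu S : measurable S -> nu S <= Lmu S.
  move=> mS; change (nu S <= L%:E * mu S).
  rewrite -lee_pdivrMl//; apply: le_ereal_inf_tmp => _ [F [mF SF] <-].
  rewrite lee_pdivrMl// -nneseriesZl//.
  have mF' i : @measurable _ (measurableTypeR R) (F i).
    by apply: sub_sigma_algebra; exact: mF.
  apply: (@le_trans _ _ (\sum_(k <oo) nu (F k))).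
    exact: (@measure_sigma_subadditive _ _ _ nu S F).
  apply: lee_nneseries => // i _.
  by have [[a b] _ <-] := mF i; exact: nuI.
rewrite (eq_measure_integral rho); last first.
  by move=> A mA AD; rewrite /rho/= /mrestr setIidl.
have mfg : measurable_fun [set: R] (f \o g) by exact: measurableT_comp.
apply: (@le_trans _ _ (\int[rho]_(t in g @^-1` E) (f \o g) t)).
  by apply: ge0_subset_integral => //; [exact: mgV|exact: measurable_funTS].
have <- : \int[nu]_(y in E) f y = \int[rho]_(t in g @^-1` E) (f \o g) t.
  apply: (@ge0_integral_pushforward _ _ (measurableTypeR R) (measurableTypeR R)
    _ _ mg' rho) => //.
  exact: (measurable_funTS mf).
apply: (@le_trans _ _ (\int[Lmu]_(y in E) f y)).
  exact: (@ge0_le_measure_integral _ _ _ nu Lmu le_nu f E mE f0 mf).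
by rewrite /Lmu ge0_integral_mscale//; exact: measurable_funTS.
Qed.

End expanding_maps.

(** * Measurability *)

Section limits.
Context d (T : measurableType d) (R : realType).

(** Convergence is the Cauchy condition, a countable combination of measurable
conditions. *)
Lemma measurable_cvgn (h : (T -> R)^nat) :
  (forall n, measurable_fun [set: T] (h n)) ->
  measurable [set x | cvgn (h ^~ x)].
Proof.
move=> mh.
rewrite [X in measurable X](_ : _ = \bigcap_k \bigcup_N \bigcap_m
    [set x | `|h N x - h (N + m)%N x| < k.+1%:R^-1]).
  apply: bigcapT_measurable => k; apply: bigcupT_measurable => N.
  apply: bigcapT_measurable => m.
  rewrite [X in measurable X](_ : _ =
    (fun x => `|h N x - h (N + m)%N x|) @^-1` `]-oo, k.+1%:R^-1[%classic).
    rewrite -[X in measurable X]setTI.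
    by apply: (measurableT_comp (@normr_measurable R setT)) => //;
      exact: measurable_funB.
  by apply/seteqP; split=> x /=; rewrite in_itv.
apply/seteqP; split=> [x /= hx k _|x /= hx].
  have k0 : 0 < k.+1%:R^-1 / 2 :> R by rewrite divr_gt0// invr_gt0.
  have /cvgrPdist_lt/(_ _ k0)[N _ hN] :
    h n x @[n --> \oo] --> limn (h ^~ x) by [].
  exists N => // m _ /=.
  have := hN N (leqnn N); have := hN (N + m)%N (leq_addr m N).
  move=> /= h1 h2; rewrite (splitr (k.+1%:R^-1)).
  rewrite (le_lt_trans (ler_distD (limn (h ^~ x)) _ _))// ltrD//.
  by rewrite distrC.
apply/cauchy_cvgP/cauchy_exP => e e0.
have [k ke] := ltr_add_invr e0; rewrite add0r in ke.
have [N _ hN] := hx k Logic.I.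
exists (h N x); exists N => // n /= Nn.
rewrite /ball/=; have := hN (n - N)%N Logic.I.
by rewrite /= subnKC// => /lt_trans; apply.
Qed.

(** Where the sequence diverges, [limn] is the constant [point], so replacing
the terms by [point] there gives a sequence of measurable functions that
converges everywhere to the same limit. *)
Lemma measurable_fun_limn (h : (T -> R)^nat) :
  (forall n, measurable_fun [set: T] (h n)) ->
  measurable_fun [set: T] (fun x => limn (h ^~ x)).
Proof.
move=> mh; pose C := [set x | cvgn (h ^~ x)].
have mC : measurable C by exact: measurable_cvgn.
apply: (@measurable_fun_cvg _ _ _ _
  (fun n x => if x \in C then h n x else point)).
  move=> n; apply: measurable_fun_ifT => //.
  apply: (measurable_fun_bool true) => //; rewrite setTI.
  rewrite [X in measurable X](_ : _ = C)//.
  by apply/seteqP; split=> x /=; [move/set_mem|move/mem_set].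
move=> x _; have [/set_mem Cx|/negP xC] := boolP (x \in C); first exact: Cx.
rewrite dvgP; first exact: cvg_cst.
by move=> Cx; apply: xC; rewrite inE.
Qed.

End limits.

Section measurability.
Context {R : realType}.
Implicit Types (x s t : R) (k K n : nat).

Lemma measurable_inv_real : measurable_fun [set: R] (@GRing.inv R).
Proof.
rewrite -(setUv [set (0 : R)]); apply/measurable_funU => //.
  exact: measurableC.
split; first exact: measurable_fun_set1.
apply: open_continuous_measurable_fun.
  exact/closed_openC/accessible_closed_set1/hausdorff_accessible/Rhausdorff.
by move=> x; rewrite inE/= => /eqP x0; exact: inv_continuous.
Qed.

Lemma measurable_floor_inv :
  measurable_fun [set: R] (fun x : R => (Num.floor (1 / x))%:~R : R).
Proof.
apply: (@measurableT_comp _ _ _ _ _ _ (fun y : R => (Num.floor y)%:~R : R)).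
  by apply: nondecreasing_measurable => // a b ab; rewrite ler_int le_floor.
under eq_fun do rewrite div1r.
exact: measurable_inv_real.
Qed.

Lemma measurable_gauss_map : measurable_fun [set: R] (@gauss_map R).
Proof.
rewrite /gauss_map /frac_part; apply: measurable_funB.
  by under eq_fun do rewrite div1r; exact: measurable_inv_real.
exact: measurable_floor_inv.
Qed.

Lemma measurable_gauss_iter k : measurable_fun [set: R] (@gauss_iter R k).
Proof.
elim: k => [|k IH]; first exact: measurable_id.
exact: (measurableT_comp measurable_gauss_map IH).
Qed.

Lemma measurable_beta_pred k : measurable_fun [set: R] (@beta_pred R k).
Proof.
elim: k => [|k IH].
  rewrite (_ : beta_pred 0 = cst 1); first exact: measurable_cst.
  by apply/funext => x; exact: beta_pred0.
rewrite (_ : beta_pred k.+1 = (fun x : R => beta_pred k x * gauss_iter k x)).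
  2: by apply/funext => x; exact: beta_predS.
by apply: measurable_funM => //; exact: measurable_gauss_iter.
Qed.

Lemma measurable_wilton_gamma k : measurable_fun [set: R] (@wilton_gamma R k).
Proof.
apply: measurable_funM; first exact: measurable_beta_pred.
apply: (@measurableT_comp _ _ _ _ _ _ (@ln R)); first exact: measurable_ln.
under eq_fun do rewrite div1r.
exact: (measurableT_comp measurable_inv_real (measurable_gauss_iter k)).
Qed.

Lemma measurable_cell K x : measurable (cell K x : set R).
Proof.
elim: K x => [|K IH] x.
  rewrite [X in measurable X](_ : _ = `]0, 1[%classic)//.
  by apply/seteqP; split=> t /=; rewrite in_itv/= => /cell0.
rewrite [X in measurable X](_ : _ = `]0, 1[%classic `&`
    ((fun t : R => (Num.floor (1 / t))%:~R) @^-1`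
       [set (Num.floor (1 / x))%:~R : R] `&`
     @gauss_map R @^-1` cell K (gauss_map x))).
  apply: measurableI => //; apply: measurableI.
  - by rewrite -[X in measurable X]setTI; exact: measurable_floor_inv.
  - by rewrite -[X in measurable X]setTI; exact: measurable_gauss_map.
apply/seteqP; split=> t.
  by move=> /cellS[t01 tx tK] /=; rewrite in_itv/= tx.
by move=> /=; rewrite in_itv/= => -[t01 [/intr_inj tx tK]]; exact/cellS.
Qed.

Lemma measurable_wilton_series n :
  measurable_fun [set: R] (fun x => wilton_series x n : R).
Proof.
rewrite /wilton_series /series/=; apply: measurable_sum => k.
by apply: measurable_funM => //; exact: measurable_wilton_gamma.
Qed.

Lemma measurable_wilton_function : measurable_fun [set: R] (@wilton_function R).
Proof. by apply: measurable_fun_limn; exact: measurable_wilton_series. Qed.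

End measurability.

(** * Integrals over cells *)

Section cell_integrals.
Context {R : realType}.
Notation mu := (@lebesgue_measure R).
Implicit Types (x s t : R) (k K n : nat) (f : R -> \bar R).

(** On the cell, B_K(t) B_K(u) is at most 4 B_K(s) B_K(x) = 16 |s - x|. *)
Lemma ge0_integral_cell_le K x s f : cell K x x -> cell K x s ->
  `|s - x| = beta_pred K s * beta_pred K x / 4 ->
  measurable_fun [set: R] f -> (forall y, 0 <= f y)%E ->
  (\int[mu]_(t in cell K x) f (gauss_iter K t) <=
   (16 * `|s - x|)%:E * \int[mu]_(y in `]0%R, 1%R[) f y)%E.
Proof.
move=> xK sK sx mf f0.
have bs := cell_beta_gt0 sK; have bx := cell_beta_gt0 xK.
apply: ge0_integral_expanding_le => //.
- by rewrite sx; nra.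
- exact: measurable_cell.
- by move=> t [/(_ K (leqnn K))]; rewrite /= in_itv.
- exact: measurable_gauss_iter.
move=> t u tK uK; rewrite (gauss_iter_dist tK uK).
apply: ler_wpM2r; first exact: normr_ge0.
have := beta_le2 tK sK; have := beta_le2 uK xK.
have := cell_beta_gt0 tK; have := cell_beta_gt0 uK; rewrite sx.
move: (beta_pred K t) (beta_pred K u) => bt bu; nra.
Qed.

Lemma le_measure_cell K x s t : cell K x s -> cell K x t ->
  (`|s - t|%:E <= mu (cell K x))%E.
Proof.
wlog st : s t / s <= t => [H|] sK tK.
  have [/H|/ltW ts] := leP s t; first exact.
  by rewrite distrC; exact: H.
rewrite distrC ger0_norm ?subr_ge0//.
rewrite (_ : (t - s)%:E = mu `[s, t]%classic); last first.
  rewrite lebesgue_measure_itv/= lte_fin; case: ltP => //.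
  by move=> ts; rewrite (@le_anti _ _ s t) ?st ?ts// subrr.
apply: le_measure; rewrite ?inE//; first exact: measurable_cell.
by move=> y /=; rewrite in_itv/=; exact: cell_convex.
Qed.

Definition digits K t : seq int :=
  [seq Num.floor (1 / gauss_iter k t) | k <- iota 0 K].

(** The cells of depth K, indexed by nat through a numbering of the sequences
of partial quotients, so as to sum over them. *)
Definition cell_code K n : set R :=
  [set t | cell K t t /\ choice.pickle (digits K t) = n].

Lemma cell_codeE K n x : cell_code K n x -> cell_code K n = cell K x.
Proof.
move=> [xK xn]; apply/seteqP; split=> t.
  move=> [[t01 _]]; rewrite -xn => /(pcan_inj choice.pickleK)/eq_in_map tx.
  by split=> // k kK; apply: tx; rewrite mem_iota.
move=> tK; split; first exact: (cell_trans tK tK).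
rewrite -xn; congr choice.pickle; apply/eq_in_map => k.
by rewrite mem_iota => /=; case: tK => _; apply.
Qed.

Lemma cell_code_cases K n :
  cell_code K n = set0 \/ exists2 x, cell K x x & cell_code K n = cell K x.
Proof.
have [->|/set0P[x xKn]] := eqVneq (cell_code K n) set0; first by left.
by right; exists x; [case: xKn|exact: cell_codeE].
Qed.

Lemma measurable_cell_code K n : measurable (cell_code K n).
Proof.
by have [->//|[x _ ->]] := cell_code_cases K n; exact: measurable_cell.
Qed.

Lemma bigcup_cell_code K : \bigcup_n cell_code K n = [set t | cell K t t].
Proof.
apply/seteqP; split=> [t [n _ []]//|t tK].
by exists (choice.pickle (digits K t)).
Qed.

Lemma trivIset_cell_code K : trivIset setT (cell_code K).
Proof. by move=> m n _ _ [t [[_ <-] [_ <-]]]. Qed.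

Lemma measurable_self_cell K : measurable [set t : R | cell K t t].
Proof.
rewrite -bigcup_cell_code; apply: bigcupT_measurable => n.
exact: measurable_cell_code.
Qed.

(** The segment from x to its companion lies in the cell, so |s - x| is at most
the measure of the cell; the cells are disjoint subsets of ]0, 1[, so summing
the estimate of [ge0_integral_cell_le] leaves the factor 16. *)
Lemma ge0_integral_gauss_iter_le K f :
  measurable_fun [set: R] f -> (forall y, 0 <= f y)%E ->
  (\int[mu]_(t in [set t | cell K t t]) f (gauss_iter K t) <=
   16%:E * \int[mu]_(y in `]0%R, 1%R[) f y)%E.
Proof.
move=> mf f0; have mfg : measurable_fun [set: R] (fun t => f (gauss_iter K t)).
  exact: (measurableT_comp mf (measurable_gauss_iter K)).
have I0 : (0 <= \int[mu]_(y in `]0%R, 1%R[) f y)%E by exact: integral_ge0.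
have [Ioo|Ioo] := eqVneq (\int[mu]_(y in `]0%R, 1%R[) f y)%E +oo%E.
  by rewrite Ioo gt0_muley ?leey// lte_fin.
have Ifin : (\int[mu]_(y in `]0%R, 1%R[) f y)%E \is a fin_num.
  by rewrite ge0_fin_numE// lt_neqAle Ioo leey.
rewrite -bigcup_cell_code ge0_integral_bigcup//; last 3 first.
- exact: measurable_cell_code.
- exact: measurable_funTS.
- exact: trivIset_cell_code.
set I := fine (\int[mu]_(y in `]0%R, 1%R[) f y)%E.
have IE : (\int[mu]_(y in `]0%R, 1%R[) f y = I%:E)%E by rewrite /I fineK.
apply: (@le_trans _ _ (\sum_(n <oo) (16 * I)%:E * mu (cell_code K n))%E).
  apply: lee_nneseries => [n _ _|n _]; first exact: integral_ge0.
  have [->|[x xK ->]] := cell_code_cases K n.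
    by rewrite integral_set0 measure0 mule0.
  have [s sK sx] := cell_companion xK.
  apply: (le_trans (ge0_integral_cell_le xK sK sx mf f0)).
  rewrite IE -EFinM mulrAC (EFinM (16 * I)); apply: lee_wpmul2l.
    by rewrite lee_fin mulr_ge0// /I fine_ge0.
  exact: le_measure_cell.
rewrite nneseriesZl// IE EFinM -[leRHS]mule1; apply: lee_wpmul2l.
  by rewrite -EFinM lee_fin mulr_ge0// /I fine_ge0.
rewrite -measure_semi_bigcup//; last 3 first.
- exact: measurable_cell_code.
- exact: trivIset_cell_code.
- by rewrite bigcup_cell_code; exact: measurable_self_cell.
rewrite bigcup_cell_code (@le_trans _ _ (mu `]0, 1[%classic))//.
  apply: le_measure; rewrite ?inE//; first exact: measurable_self_cell.
  by move=> t /cell_itv; rewrite /= in_itv.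
by rewrite lebesgue_measure_itv/= lte_fin ltr01 oppr0 adde0.
Qed.

End cell_integrals.

(** * An integrable majorant *)

Section majorant.
Context {R : realType}.
Notation mu := (@lebesgue_measure R).
Implicit Types (x s t u : R) (k K n : nat) (f : R -> \bar R).

Lemma measurable_abs_ln_inv :
  measurable_fun [set: R] (fun u : R => (`|ln (1 / u)|)%:E).
Proof.
apply/measurable_EFinP; apply: (measurableT_comp (@normr_measurable R setT)).
apply: (@measurableT_comp _ _ _ _ _ _ (@ln R)); first exact: measurable_ln.
by under eq_fun do rewrite div1r; exact: measurable_inv_real.
Qed.

Lemma measurable_abs_wilton_gamma k :
  measurable_fun [set: R] (fun u : R => (`|wilton_gamma k u|)%:E).
Proof.
apply/measurable_EFinP; apply: (measurableT_comp (@normr_measurable R setT)).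
exact: measurable_wilton_gamma.
Qed.

Lemma nneseries_geometric_le (a z : R) : 0 <= a -> 0 <= z < 1 ->
  (\sum_(n <oo) (a * z ^+ n)%:E <= (a / (1 - z))%:E)%E.
Proof.
move=> a0 /andP[z0 z1].
have az0 n : 0 <= a * z ^+ n by rewrite mulr_ge0// exprn_ge0.
apply: lime_le; first by apply: is_cvg_nneseries => n _ _; rewrite lee_fin.
apply: nearW => n; rewrite sumEFin lee_fin.
have := @geometric_seriesE R a z (negbT (lt_eqF z1)).
move/(congr1 (fun h => h n)); rewrite /series /geometric /= => ->.
rewrite ler_wpM2r ?invr_ge0 ?subr_ge0 ?(ltW z1)//.
by rewrite ler_piMr// lerBlDr lerDl exprn_ge0.
Qed.

Lemma ln_inv_ge0 u : 0 < u < 1 -> 0 <= ln (1 / u).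
Proof.
by move=> /andP[u0 u1]; rewrite ln_ge0// div1r invf_ge1// ltW.
Qed.

(** The number of n with u <= 2^-n is at least the number of n <= ln(1/u),
because ln 2 <= 1. Integrating the layers then bounds the integral of ln(1/u)
by a geometric series. *)
Lemma ln_inv_le_layers u : 0 < u < 1 ->
  ((ln (1 / u))%:E <= \sum_(n <oo) (\1_`]0%R, (2^-1) ^+ n] u)%:E)%E.
Proof.
move=> u01; have /andP[u0 u1] := u01; have l0 := ln_inv_ge0 u01.
have /andP[mle ltm] := truncn_itv l0; set m := Num.truncn _ in mle ltm.
apply: (@le_trans _ _ (\sum_(0 <= n < m.+1) (\1_`]0%R, (2^-1) ^+ n] u)%:E)%E);
  last first.
  by apply: nneseries_lim_ge => n _ _; rewrite lee_fin.
rewrite (eq_big_nat _ _ (F2 := fun=> 1%E)).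
  by rewrite sumEFin lee_fin sumr_const_nat subn0 ltW.
move=> n /andP[_ nm]; rewrite indicE mem_set//=.
rewrite in_itv/= u0/= exprVn -[u]invrK lef_pV2 ?posrE ?exprn_gt0 ?invr_gt0//.
rewrite -ler_ln ?posrE ?exprn_gt0 ?invr_gt0// lnXn// -div1r (le_trans _ mle)//.
apply: (@le_trans _ _ (1 *+ n)); last by rewrite ler_nat.
rewrite lerMn2r; apply/orP; right.
have -> : 2 = 1 + 1 :> R by [].
by apply: le_ln1Dx; lra.
Qed.

Lemma integral_ln_inv_lty :
  (\int[mu]_(u in `]0%R, 1%R[) (`|ln (1 / u)|)%:E < +oo)%E.
Proof.
have mI n : measurable (`]0%R, (2^-1) ^+ n]%classic : set R) by [].
apply: (@le_lt_trans _ _ (\int[mu]_(u in `]0%R, 1%R[)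
    \sum_(n <oo) (\1_`]0%R, (2^-1) ^+ n] u)%:E)%E).
  apply: ge0_le_integral => //.
  - by apply: measurable_funTS; exact: measurable_abs_ln_inv.
  - apply: measurable_funTS.
    apply: (@ge0_emeasurable_sum _ _ R setT
      (fun n u => (\1_`]0%R, (2^-1) ^+ n] u)%:E) xpredT) => [n u _ _|n _].
      by rewrite lee_fin.
    by apply/measurable_EFinP; exact: measurable_indic.
  - move=> u; rewrite /= in_itv/= => u01.
    by rewrite ger0_norm ?ln_inv_ge0// ln_inv_le_layers.
rewrite integral_nneseries//; last first.
  by move=> n; apply/measurable_EFinP; exact: measurable_indic.
apply: (@le_lt_trans _ _ (\sum_(n <oo) (1 * (2^-1) ^+ n)%:E)%E).
  apply: lee_nneseries => [n _ _|n _]; first exact: integral_ge0.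
  rewrite integral_indic// (@le_trans _ _ (mu `]0, (2^-1) ^+ n]%classic))//.
    by apply: le_measure; rewrite ?inE//; exact: measurableI.
  rewrite lebesgue_measure_itv/= lte_fin exprn_gt0 ?invr_gt0//.
  by rewrite oppr0 adde0 mul1r.
have z01 : 0 <= (2^-1 : R) < 1 by lra.
by rewrite (le_lt_trans (nneseries_geometric_le ler01 z01))// ltry.
Qed.

(** Finite exactly where the series of W converges absolutely. *)
Definition wilton_majorant t : \bar R :=
  (\sum_(k <oo) (`|wilton_gamma k t|)%:E)%E.

Lemma wilton_majorant_ge0 t : (0 <= wilton_majorant t)%E.
Proof. by apply: nneseries_ge0 => n _ _; rewrite lee_fin. Qed.

Lemma measurable_wilton_majorant : measurable_fun [set: R] wilton_majorant.
Proof.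
apply: (@ge0_emeasurable_sum _ _ R setT
  (fun n u => (`|wilton_gamma n u|)%:E) xpredT) => [n u _ _|n _].
  by rewrite lee_fin.
exact: measurable_abs_wilton_gamma.
Qed.

Lemma irrational_gauss_map t : irrational01 t -> irrational01 (gauss_map t).
Proof.
move=> [/=]; rewrite in_itv/= => /andP[t0 t1] tirr.
have air : irrational (gauss_map t).
  move=> /= [q _ qE]; apply: tirr.
  exists ((Num.floor (1 / t))%:~R + q)^-1 => //.
  by rewrite fmorphV rmorphD/= ratr_int qE -inv_gauss_mapE invrK.
split=> //=; rewrite in_itv/=.
have /andP[a0 ->] := gauss_map_itv t; rewrite andbT lt_neqAle a0 andbT.
by apply/eqP => a0E; apply: air; exists 0 => //; rewrite rmorph0.
Qed.

Lemma irrational_gauss_iter k t :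
  irrational01 t -> irrational01 (gauss_iter k t).
Proof. by elim: k => // k IH /IH; exact: irrational_gauss_map. Qed.

Lemma irrational_cell K t : irrational01 t -> cell K t t.
Proof.
move=> tirr; split=> // k _.
by have [/=] := irrational_gauss_iter k tirr; rewrite in_itv.
Qed.

Lemma measurable_rational : measurable (@rational R).
Proof.
apply: countable_measurable => //; rewrite /rational.
exact: (sub_countable (card_image_le _ _) (countableP _)).
Qed.

Lemma rational_null : mu (@rational R) = 0%E.
Proof. exact: lebesgue_measure_rat. Qed.

Lemma irrational01E : @irrational01 R = `]0, 1[ `\` @rational R.
Proof. by []. Qed.

Lemma measurable_irrational01 : measurable (@irrational01 R).
Proof.
by rewrite irrational01E; apply: measurableD => //; exact: measurable_rational.
Qed.

Lemma irrational01_cc : @irrational01 R = `[0, 1] `\` @rational R.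
Proof.
apply/seteqP; split=> t [/=]; rewrite in_itv/= => /andP[t0 t1] tirr.
  by split=> //=; rewrite in_itv/= !ltW.
split=> //=; rewrite in_itv/= !lt_neqAle t0 t1 !andbT.
apply/andP; split; apply/eqP => tE; apply: tirr.
  by exists 0 => //; rewrite rmorph0.
by exists 1 => //; rewrite rmorph1.
Qed.

Lemma integral_wilton_gamma_le k :
  (\int[mu]_(t in @irrational01 R) (`|wilton_gamma k t|)%:E <=
   (2 * (3 / 4) ^+ k * 16)%:E *
     \int[mu]_(u in `]0%R, 1%R[) (`|ln (1 / u)|)%:E)%E.
Proof.
have c0 : 0 <= 2 * (3 / 4) ^+ k :> R by rewrite mulr_ge0// exprn_ge0.
have mln := measurable_abs_ln_inv.
have mlng :
    measurable_fun [set: R] (fun t : R => (`|ln (1 / gauss_iter k t)|)%:E).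
  exact: (measurableT_comp mln (measurable_gauss_iter k)).
have mE := @measurable_self_cell R k.
apply: (@le_trans _ _ (\int[mu]_(t in [set t | cell k t t])
    ((2 * (3 / 4) ^+ k)%:E * (`|ln (1 / gauss_iter k t)|)%:E))%E).
  apply: (@le_trans _ _ (\int[mu]_(t in [set t | cell k t t])
      (`|wilton_gamma k t|)%:E)%E).
    apply: ge0_subset_integral => //; first exact: measurable_irrational01.
    - by apply: measurable_funTS; exact: measurable_abs_wilton_gamma.
    - by move=> t; exact: irrational_cell.
  apply: ge0_le_integral => //.
  - by apply: measurable_funTS; exact: measurable_abs_wilton_gamma.
  - by apply: measurable_funTS; apply: emeasurable_funM.
  - move=> t tk; rewrite -EFinM lee_fin normrM ler_wpM2r//.
    by rewrite gtr0_norm ?(cell_beta_gt0 tk)// beta_pred_le// (cell_itvW tk).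
rewrite ge0_integralZl_EFin//; last exact: measurable_funTS.
rewrite (EFinM (2 * (3 / 4) ^+ k)) -muleA.
apply: lee_wpmul2l; rewrite ?lee_fin//.
exact: (ge0_integral_gauss_iter_le k mln).
Qed.

Lemma integral_wilton_majorant_lty :
  (\int[mu]_(t in `]0%R, 1%R[) wilton_majorant t < +oo)%E.
Proof.
rewrite (@ge0_negligible_integral _ (measurableTypeR R) R mu _
  (@rational R))//; last 4 first.
- exact: measurable_rational.
- by apply: measurable_funTS; exact: measurable_wilton_majorant.
- by move=> t _; exact: wilton_majorant_ge0.
- exact: rational_null.
have mg k :
    measurable_fun (@irrational01 R) (fun t => (`|wilton_gamma k t|)%:E).
  by apply: measurable_funTS; exact: measurable_abs_wilton_gamma.
rewrite integral_nneseries//; last exact: measurable_irrational01.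
have lnoo := integral_ln_inv_lty.
set J := (\int[mu]_(u in `]0%R, 1%R[) (`|ln (1 / u)|)%:E)%E in lnoo.
have J0 : (0 <= J)%E by apply: integral_ge0 => u _; rewrite lee_fin.
have JE : J = (fine J)%:E by rewrite fineK// ge0_fin_numE.
apply: (@le_lt_trans _ _ (\sum_(k <oo) ((32 * fine J) * (3 / 4) ^+ k)%:E)%E).
  apply: lee_nneseries => [n _ _|n _]; first exact: integral_ge0.
  apply: (le_trans (integral_wilton_gamma_le n)); rewrite -/J JE -EFinM lee_fin.
  by rewrite le_eqVlt; apply/orP; left; apply/eqP => /=; ring.
have a0 : 0 <= 32 * fine J by rewrite mulr_ge0// fine_ge0.
have z01 : 0 <= (3 / 4 : R) < 1 by lra.
by rewrite (le_lt_trans (nneseries_geometric_le a0 z01))// ltry.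
Qed.

End majorant.

(** * Partial sums and remainders *)

Section pointwise.
Context {R : realType}.
Implicit Types (x y s t u a b : R) (k K n : nat).

Lemma ln_inv_sub_le a b : 0 < a -> 0 < b ->
  ln (1 / a) - ln (1 / b) <= `|a - b| / a.
Proof.
move=> a0 b0; rewrite -ln_div ?posrE ?divr_gt0//.
have -> : 1 / a / (1 / b) = 1 + (b - a) / a by field; rewrite !gt_eqF.
apply: (@le_trans _ _ ((b - a) / a)).
  apply: le_ln1Dx; rewrite mulrBl divff ?gt_eqF// ltrDr divr_gt0//.
by rewrite ler_pM2r ?invr_gt0// distrC ler_norm.
Qed.

(** With a = a_k(t), c = a_k(x) and T, X the products of the iterates of t and
x of ranks k + 1, ..., K - 1, the distance formula gives |a - c| <= a T c X.
This controls the logarithms through |ln a - ln c| <= |a - c| / min(a, c) and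
B_k through [beta_dist], where a ln(1/a) <= 1 absorbs the logarithm. *)
Lemma wilton_gamma_variation K x t k : cell K x x -> cell K x t -> (k < K)%N ->
  `|wilton_gamma k t - wilton_gamma k x| <=
    3 * beta_pred K x * beta_pred (K - k.+1) (gauss_iter k.+1 t).
Proof.
move=> xK tK kK.
have EK : (k + (1 + (K - k.+1)) = K)%N by rewrite addnA addn1 subnKC.
have xk := cell_le (ltnW kK) xK; have tk := cell_le (ltnW kK) tK.
have xk' : cell (1 + (K - k.+1)) (gauss_iter k x) (gauss_iter k x).
  by apply: cell_gauss_iter; rewrite EK.
have tk' : cell (1 + (K - k.+1)) (gauss_iter k x) (gauss_iter k t).
  by apply: cell_gauss_iter; rewrite EK.
have := gauss_iter_dist tk' xk'.
have -> : beta_pred K x = beta_pred k x *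
    (gauss_iter k x * beta_pred (K - k.+1) (gauss_iter k.+1 x)).
  by rewrite -{1}EK beta_predD beta_predSr.
rewrite !beta_predSr -!/(gauss_iter k.+1 _).
have dist_le1 : `|gauss_iter (1 + (K - k.+1)) (gauss_iter k t) -
    gauss_iter (1 + (K - k.+1)) (gauss_iter k x)| <= 1.
  have /andP[? ?] := tk'.1 _ (leqnn _); have /andP[? ?] := xk'.1 _ (leqnn _).
  by rewrite ler_norml; lra.
have bdist := beta_dist tk xk.
have b0 := cell_beta_gt0 xk.
have /andP[a0 a1] := cell_itv tk'; have /andP[c0 c1] := cell_itv xk'.
have T01 : 0 <= beta_pred (K - k.+1) (gauss_iter k.+1 t) <= 1.
  by rewrite beta_pred_ge0 ?beta_pred_le1// gauss_map_itv.
have X01 : 0 <= beta_pred (K - k.+1) (gauss_iter k.+1 x) <= 1.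
  by rewrite beta_pred_ge0 ?beta_pred_le1// gauss_map_itv.
have l0 := ln_inv_ge0 (cell_itv tk').
have la : gauss_iter k t * ln (1 / gauss_iter k t) <= 1.
  rewrite mulrC -ler_pdivlMr//; apply: ltW; apply: ln_sublinear.
  by rewrite divr_gt0.
have l1 := ln_inv_sub_le a0 c0; have l2 := ln_inv_sub_le c0 a0.
rewrite /wilton_gamma.
move: (gauss_iter _ (gauss_iter k t)) (gauss_iter _ (gauss_iter k x)) dist_le1.
move: (gauss_iter k t) (gauss_iter k x) (beta_pred k t) (beta_pred k x)
  (beta_pred _ (gauss_iter k.+1 t)) (beta_pred _ (gauss_iter k.+1 x))
  bdist b0 a0 a1 c0 c1 T01 X01 l0 la l1 l2
  => a c bt b T X bdist b0 a0 a1 c0 c1 /andP[T0 T1] /andP[X0 X1] l0 la l1 l2.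
move=> u v uv1 dE.
have dE' : `|a - c| <= a * T * (c * X) by rewrite dE ler_piMr// !mulr_ge0// ltW.
move: l1 l2; rewrite [`|c - a|]distrC !ler_pdivlMr// => l1 l2.
move: (ln (1 / a)) (ln (1 / c)) l0 la l1 l2 => la lc l0 lale l1 l2.
have cX1 : c * X <= c by rewrite ler_piMr// ltW.
have TcX0 : 0 <= c * X * T by rewrite !mulr_ge0// ltW.
(* The two iterates are comparable: |a - c| <= c since a T X <= 1. *)
have a2c : a <= 2 * c.
  have : a * T * (c * X) <= c.
    by rewrite -[leRHS]mul1r ler_pM// ?mulr_ile1 ?mulr_ge0// ltW.
  by have := ler_norm (a - c); lra.
have -> : bt * la - b * lc = (bt - b) * la + b * (la - lc) by ring.
apply: (le_trans (ler_normD _ _)).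
rewrite !normrM (ger0_norm l0) (gtr0_norm b0).
have -> : 3 * (b * (c * X)) * T = b * (c * X) * T + b * (2 * (c * X * T)).
  by ring.
have -> : b * (c * X) * T = b * (c * X * T) by ring.
apply: lerD.
  apply: (@le_trans _ _ (b * `|a - c| * la)); first exact: ler_wpM2r.
  rewrite -mulrA; apply: ler_wpM2l; first exact: ltW.
  apply: (@le_trans _ _ (a * T * (c * X) * la)); first exact: ler_wpM2r.
  rewrite (_ : _ * la = (a * la) * (c * X * T)); last by ring.
  by rewrite ler_piMl.
apply: ler_wpM2l; first exact: ltW.
have l1' : la - lc <= c * X * T.
  rewrite -(ler_pM2r a0); apply: (le_trans l1); apply: (le_trans dE').
  by rewrite le_eqVlt; apply/orP; left; apply/eqP; ring.
have l2' : lc - la <= a * (X * T).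
  rewrite -(ler_pM2r c0); apply: (le_trans l2); apply: (le_trans dE').
  by rewrite le_eqVlt; apply/orP; left; apply/eqP; ring.
have : a * (X * T) <= 2 * c * (X * T) by rewrite ler_wpM2r// mulr_ge0.
by rewrite ler_norml => l3; apply/andP; split; lra.
Qed.

(** The last factor in [wilton_gamma_variation] decays geometrically as K - k
grows, so the sum over k stays of order B_K(x). *)
Lemma wilton_series_variation K x t : cell K x x -> cell K x t ->
  `|wilton_series t K - wilton_series x K| <= 24 * beta_pred K x.
Proof.
move=> xK tK; have bx := cell_beta_gt0 xK.
rewrite /wilton_series /series/= -sumrB.
apply: (le_trans (ler_norm_sum _ _ _)).
apply: (@le_trans _ _ (\sum_(0 <= k < K)
    (3 * beta_pred K x * 2) * (3 / 4) ^+ (K - k.+1))).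
  rewrite big_nat [leRHS]big_nat; apply: ler_sum => k /andP[_ kK].
  rewrite -mulrBr normrM normrX normrN1 expr1n mul1r.
  apply: (le_trans (wilton_gamma_variation xK tK kK)).
  rewrite -[leRHS]mulrA; apply: ler_wpM2l; first by lra.
  exact/beta_pred_le/gauss_map_itv.
rewrite big_nat_rev/= add0n -mulr_sumr.
have E : \sum_(0 <= k < K) (3 / 4 : R) ^+ (K - (K - k.+1).+1) =
    series (geometric 1 (3 / 4)) K.
  rewrite /series/=; apply: eq_big_nat => k /andP[_ kK].
  by rewrite /geometric/= mul1r subnSK// subKn// ltnW.
rewrite E geometric_seriesE/=; last by rewrite lt_eqF//; lra.
have : 0 <= (3 / 4 : R) ^+ K by rewrite exprn_ge0.
move: (_ ^+ K) => p p0.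
have -> : 1 * (1 - p) / (1 - 3 / 4) = 4 * (1 - p) :> R by field.
nra.
Qed.

Lemma wilton_gamma_shift K j t :
  wilton_gamma (K + j) t = beta_pred K t * wilton_gamma j (gauss_iter K t).
Proof. by rewrite /wilton_gamma beta_predD -mulrA addnC gauss_iterD. Qed.

Lemma wilton_series_shift K n t :
  wilton_series t (K + n)%N - wilton_series t K =
  \sum_(0 <= j < n) (-1) ^+ (K + j) * wilton_gamma (K + j) t.
Proof.
elim: n => [|n IH]; first by rewrite addn0 subrr big_nil.
rewrite big_nat_recr//= -IH addnS /wilton_series /series/=.
rewrite (@big_nat_recr _ _ _ (K + n))//=.
by rewrite addrAC.
Qed.

Lemma wilton_majorant_partial y n : (wilton_majorant y < +oo)%E ->
  \sum_(0 <= k < n) `|wilton_gamma k y| <= fine (wilton_majorant y).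
Proof.
move=> yoo; rewrite -lee_fin fineK ?ge0_fin_numE ?wilton_majorant_ge0//.
rewrite -sumEFin; apply: nneseries_lim_ge => k _ _.
by rewrite lee_fin.
Qed.

(** The remainder of the series at t is, up to sign and the factor B_K(t), the
series at a_K(t). *)
Lemma wilton_tail_le K t : irrational01 t -> (wilton_majorant t < +oo)%E ->
  ((`|wilton_function t - wilton_series t K|)%:E <=
   (beta_pred K t)%:E * wilton_majorant (gauss_iter K t))%E.
Proof.
move=> tirr Phi_t; have tK := irrational_cell K tirr.
have bt := cell_beta_gt0 tK.
have cvg_t : cvgn (wilton_series t).
  apply: normed_cvg; apply: nondecreasing_is_cvgn.
    apply/nondecreasing_seqP => n; by rewrite -subr_ge0 seriesSB normr_ge0.
  exists (fine (wilton_majorant t)) => _ [n _ <-].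
  rewrite /= /normed_series_of seriesEnat.
  apply: (le_trans _ (wilton_majorant_partial n Phi_t)); apply: ler_sum.
  by move=> k _; rewrite normrM normrX normrN1 expr1n mul1r.
have Phi0 := wilton_majorant_ge0 (gauss_iter K t).
have [->|Phi_oo] := eqVneq (wilton_majorant (gauss_iter K t)) +oo%E.
  by rewrite gt0_muley ?leey// lte_fin.
have PhiE : wilton_majorant (gauss_iter K t) =
    (fine (wilton_majorant (gauss_iter K t)))%:E.
  by rewrite fineK// ge0_fin_numE// lt_neqAle Phi_oo leey.
have tail n : `|wilton_series t (K + n)%N - wilton_series t K| <=
    beta_pred K t * fine (wilton_majorant (gauss_iter K t)).
  rewrite wilton_series_shift; apply: (le_trans (ler_norm_sum _ _ _)).
  under eq_bigr do rewrite normrM normrX normrN1 expr1n mul1r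
    wilton_gamma_shift normrM (gtr0_norm bt).
  rewrite -mulr_sumr; apply: ler_wpM2l; first exact: ltW.
  by apply: wilton_majorant_partial; rewrite lt_neqAle Phi_oo leey.
rewrite PhiE -EFinM lee_fin; apply/ler_addgt0Pr => e e0.
have /cvgrPdist_lt/(_ _ e0)[N _ hN] :
  wilton_series t n @[n --> \oo] --> wilton_function t by exact: cvg_t.
rewrite (le_trans (ler_distD (wilton_series t (K + N)%N) _ _))// addrC lerD//.
by apply/ltW/hN => /=; rewrite leq_addl.
Qed.

End pointwise.

(** * Increments of Upsilon *)

Section increments.
Context {R : realType}.
Notation mu := (@lebesgue_measure R).
Implicit Types (x y s t u a b : R) (k K n : nat).

Lemma ae_wilton_majorant_lty :
  {ae mu, forall t, `[0%R, 1%R]%classic t ->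
    irrational01 t /\ (wilton_majorant t < +oo)%E}.
Proof.
have iPhi : mu.-integrable `]0%R, 1%R[ (@wilton_majorant R).
  apply/integrableP; split.
    by apply: measurable_funTS; exact: measurable_wilton_majorant.
  under eq_integral do rewrite gee0_abs ?wilton_majorant_ge0//.
  exact: integral_wilton_majorant_lty.
have m01 : @measurable _ (measurableTypeR R) `]0%R, 1%R[%classic.
  exact: measurable_itv.
have aefin := integrable_ae m01 iPhi.
have aeirr : {ae mu, forall t, ~ @rational R t}.
  exists (@rational R); split.
  - exact: measurable_rational.
  - exact: rational_null.
  - by move=> t /= /contrapT.
apply: filterS2 aefin aeirr => t /= tfin tirr t01.
have tX : irrational01 t by rewrite irrational01_cc.
split=> //; rewrite -ge0_fin_numE ?wilton_majorant_ge0//.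
by apply: tfin; case: tX.
Qed.

Lemma integrable_wilton_function :
  mu.-integrable `[0%R, 1%R] (EFin \o @wilton_function R).
Proof.
apply/integrableP; split.
  apply/measurable_EFinP; apply: measurable_funTS.
  exact: measurable_wilton_function.
apply: (@le_lt_trans _ _ (\int[mu]_(t in `[0%R, 1%R]) wilton_majorant t)%E).
  apply: ae_ge0_le_integral => //.
  - apply/measurable_EFinP; apply: measurable_funTS.
    apply: (measurableT_comp (@normr_measurable R setT)).
    exact: measurable_wilton_function.
  - by move=> t _; exact: wilton_majorant_ge0.
  - by apply: measurable_funTS; exact: measurable_wilton_majorant.
  apply: (@filterS _ _ (ae_filter_ringOfSetsType mu) _ _ _
    ae_wilton_majorant_lty) => t /= tX /tX[tirr tfin].
  have := wilton_tail_le 0 tirr tfin.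
  by rewrite beta_pred0 mul1e /wilton_series /series/= big_nil subr0.
rewrite (@ge0_negligible_integral _ (measurableTypeR R) R mu _ (@rational R))//.
- rewrite -irrational01_cc irrational01E.
  rewrite -(@ge0_negligible_integral _ (measurableTypeR R) R mu _
    (@rational R))//.
  + exact: integral_wilton_majorant_lty.
  + exact: measurable_rational.
  + by apply: measurable_funTS; exact: measurable_wilton_majorant.
  + by move=> t _; exact: wilton_majorant_ge0.
  + exact: rational_null.
- exact: measurable_rational.
- by apply: measurable_funTS; exact: measurable_wilton_majorant.
- by move=> t _; exact: wilton_majorant_ge0.
- exact: rational_null.
Qed.

Definition increment_const : R :=
  24 + 32 * fine (\int[mu]_(u in `]0%R, 1%R[) wilton_majorant u)%E.

(** The integrand W - S_K(x) is almost everywhere bounded by 24 B_K(x) + 2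
B_K(x) Phi(a_K), and the integral of Phi(a_K) over ]a, b] is at most 16 (b - a)
times that of Phi over ]0, 1[. *)
Lemma Upsilon_increment K x s a b : cell K x x -> cell K x s ->
  `|s - x| = beta_pred K s * beta_pred K x / 4 ->
  cell K x a -> cell K x b -> a < b -> b - a = `|s - x| ->
  `|Upsilon b - Upsilon a - (b - a) * wilton_series x K| <=
    increment_const * beta_pred K x * (b - a).
Proof.
move=> xK sK sx aK bK ab absx.
have /andP[a0 a1] := cell_itv aK; have /andP[b0 b1] := cell_itv bK.
have bx := cell_beta_gt0 xK.
set S := wilton_series x K.
have ab01 : `]a, b]%classic `<=` `[0, 1]%classic.
  move=> t /=; rewrite !in_itv/= => /andP[at_ tb].
  by rewrite (ltW (lt_trans a0 at_)) (le_trans tb (ltW b1)).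
have abK : `]a, b]%classic `<=` cell K x.
  move=> t /=; rewrite in_itv/= => /andP[/ltW at_ tb].
  by apply: (cell_convex aK bK); rewrite at_.
have iW : mu.-integrable `]a, b] (EFin \o @wilton_function R).
  exact: integrableS integrable_wilton_function.
have muab : mu `]a, b]%classic = (b - a)%:E.
  by rewrite lebesgue_measure_itv/= lte_fin ab -EFinB.
have iS : mu.-integrable `]a, b] (EFin \o cst S).
  apply/integrableP; split.
    by apply/measurable_EFinP; exact: measurable_cst.
  rewrite (eq_integral (cst `|S|%:E))//.
  by rewrite integral_cst// [X in (_ * X)%E]muab -EFinM ltry.
have -> : Upsilon b - Upsilon a = \int[mu]_(t in `]a, b]) wilton_function t.
  rewrite /Upsilon Rintegral_itvB ?bnd_simp// ?ltW//.
  apply: integrableS integrable_wilton_function => //.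
  by apply: subset_itvl; rewrite bnd_simp ltW.
have -> : (b - a) * S = \int[mu]_(t in `]a, b]) S.
  by rewrite Rintegral_cst// [X in fine X]muab mulrC.
rewrite -RintegralB//.
have iWS : mu.-integrable `]a, b] (EFin \o (fun t => wilton_function t - S)).
  by apply: eq_integrable (integrableB _ iW iS).
have mPhiK :
    measurable_fun [set: R] (fun t => wilton_majorant (gauss_iter K t)).
  exact: (measurableT_comp measurable_wilton_majorant
    (measurable_gauss_iter K)).
have PhiK0 t : (0 <= wilton_majorant (gauss_iter K t))%E.
  exact: wilton_majorant_ge0.
have b2 : (0 <= (2 * beta_pred K x)%:E)%E by rewrite lee_fin mulr_ge0// ltW.
have b24 : (0 <= (24 * beta_pred K x)%:E)%E by rewrite lee_fin mulr_ge0// ltW.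
rewrite -lee_fin EFin_normr_Rintegral//.
apply: (le_trans (le_abse_integral _ _ _)) => //.
  by case/integrableP: iWS.
apply: (@le_trans _ _ (\int[mu]_(t in `]a, b])
    ((24 * beta_pred K x)%:E +
     (2 * beta_pred K x)%:E * wilton_majorant (gauss_iter K t)))%E).
  apply: ae_ge0_le_integral => //.
  - by apply: measurableT_comp => //; case/integrableP: iWS.
  - by move=> t _; rewrite adde_ge0// mule_ge0.
  - apply: measurable_funTS; apply: emeasurable_funD => //.
    exact: emeasurable_funM.
  apply: (@filterS _ _ (ae_filter_ringOfSetsType mu) _ _ _
    ae_wilton_majorant_lty) => t /= tX tab.
  have [tirr tfin] := tX (ab01 _ tab); have tK := abK _ tab.
  rewrite (le_trans _ (leeD (lexx _) (lee_wpmul2r (PhiK0 t)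
    (_ : ((beta_pred K t)%:E <= _)%E))))//; last first.
    by rewrite lee_fin; exact: beta_le2 tK xK.
  rewrite (le_trans _ (leeD (lexx _) (wilton_tail_le K tirr tfin)))//.
  rewrite -EFinD lee_fin.
  rewrite (le_trans (ler_distD (wilton_series t K) _ _))// addrC lerD2r.
  exact: wilton_series_variation.
rewrite ge0_integralD//; last 2 first.
- by move=> t _; rewrite mule_ge0.
- by apply: measurable_funTS; exact: emeasurable_funM.
rewrite integral_cst// [X in (_ * X)%E]muab ge0_integralZl_EFin//; last first.
  exact: measurable_funTS.
set J := fine (\int[mu]_(u in `]0%R, 1%R[) wilton_majorant u)%E.
have JE : (\int[mu]_(u in `]0%R, 1%R[) @wilton_majorant R u = J%:E)%E.
  rewrite /J fineK// ge0_fin_numE; first exact: integral_wilton_majorant_lty.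
  by apply: integral_ge0 => t _; exact: wilton_majorant_ge0.
have intK : (\int[mu]_(t in `]a, b]) wilton_majorant (gauss_iter K t) <=
    (16 * (b - a) * J)%:E)%E.
  apply: (@le_trans _ _
      (\int[mu]_(t in cell K x) wilton_majorant (gauss_iter K t))%E).
    apply: ge0_subset_integral => //; first exact: measurable_cell.
    exact: measurable_funTS.
  rewrite (EFinM (16 * (b - a))) -JE absx.
  apply: (ge0_integral_cell_le xK sK sx) => //.
    exact: measurable_wilton_majorant.
  exact: wilton_majorant_ge0.
apply: (le_trans (leeD (lexx _) (lee_wpmul2l b2 intK))).
rewrite -!EFinM -EFinD lee_fin /increment_const -/J.
by rewrite le_eqVlt; apply/orP; left; apply/eqP; ring.
Qed.

Lemma beta_pred_cvg0 x : 0 <= x < 1 -> beta_pred K x @[K --> \oo] --> 0.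
Proof.
move=> x01; apply: (@squeeze_cvgr _ _ _ _ (cst 0) (geometric 2 (3 / 4))).
- by apply: nearW => K; rewrite beta_pred_ge0//= beta_pred_le.
- exact: cvg_cst.
- by apply: cvg_geometric; rewrite ger0_norm; lra.
Qed.

Lemma slope_error_le (d D S c : R) : d != 0 -> `|D - d * S| <= c * `|d| ->
  `|d^-1 * D - S| <= c.
Proof.
move=> d_neq0; have := d_neq0; rewrite -(normr_gt0 d) => nd0 H.
rewrite -(ler_pM2r nd0) -normrM.
by rewrite (_ : (d^-1 * D - S) * d = D - d * S)//; field.
Qed.

(** The depth K slope is the one between x and its companion in the cell of
depth K, which may lie on either side of x. *)
Lemma Upsilon_quotient_companion K x : irrational01 x ->
  exists2 h, h != 0 /\ `|h| <= beta_pred K x &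
  `|h^-1 * (Upsilon (h + x) - Upsilon x) - wilton_series x K| <=
    increment_const * beta_pred K x.
Proof.
move=> xirr; have xK := irrational_cell K xirr.
have [s sK sx] := cell_companion xK.
have bx := cell_beta_gt0 xK; have bs := cell_beta_gt0 sK.
have bs1 := beta_pred_le1 K (cell_itvW sK).
have h0 : 0 < `|s - x| by rewrite sx divr_gt0// mulr_gt0.
exists (s - x); first by split; [rewrite -normr_gt0|rewrite sx; nra].
rewrite subrK; have [sltx|xlts|sE] := ltgtP s x; last first.
- by move: h0; rewrite sE subrr normr0 ltxx.
- have d0 : 0 < s - x by rewrite subr_gt0.
  apply: slope_error_le; rewrite ?gt_eqF// (gtr0_norm d0).
  exact: (Upsilon_increment xK sK sx xK sK xlts (esym (gtr0_norm d0))).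
have d0 : s - x < 0 by rewrite subr_lt0.
apply: slope_error_le; rewrite ?lt_eqF// (ltr0_norm d0) opprB -normrN.
rewrite (_ : - (Upsilon s - Upsilon x - _) =
    Upsilon x - Upsilon s - (x - s) * wilton_series x K); last by ring.
by apply: (Upsilon_increment xK sK sx sK xK sltx); rewrite ltr0_norm// opprB.
Qed.

End increments.

Theorem proposition11 (R : realType) (x : R) (hX : irrational01 x)
  (hx : Wilton_Cremer_number x) : ~ derivable (@Upsilon R) x 1.
Proof.
move=> /cvg_ex[/= l dl]; case: hx => _; apply.
apply/cvg_ex; exists l; apply/cvgrPdist_lt => e e0.
have x01 : 0 <= x < 1.
  by case: hX => /=; rewrite in_itv/= => /andP[/ltW -> ->].
have e20 : 0 < e / 2 by rewrite divr_gt0.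
have /cvgrPdist_lt/(_ _ e20) := dl.
move=> [d /= d0 hd].
have := beta_pred_cvg0 x01 => bcvg.
have C0 : 0 < @increment_const R.
  rewrite /increment_const ltr_wpDr// mulr_ge0// fine_ge0//.
  by apply: integral_ge0 => t _; exact: wilton_majorant_ge0.
have /cvgrPdist_lt/(_ _ d0) bd := bcvg.
have eC0 : 0 < e / 2 / @increment_const R by rewrite divr_gt0.
have /cvgrPdist_lt/(_ _ eC0) bC := bcvg.
apply: filterS2 bd bC => K; rewrite !sub0r !normrN.
rewrite (ger0_norm (beta_pred_ge0 _ x01)) => bKd bKC.
have [h [h0 hb] hq] := Upsilon_quotient_companion K hX.
have := hd h; rewrite /= sub0r normrN => /(_ (le_lt_trans hb bKd) h0) hl.
rewrite (le_lt_trans (ler_distD (h^-1 * (Upsilon (h + x) - Upsilon x)) _ _))//.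
rewrite (splitr e) ltr_leD//.
  by move: hl; rewrite /GRing.scale/= mulr1.
by rewrite (le_trans hq)// mulrC -ler_pdivlMr// ltW.
Qed.
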